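(* Let $I\subset\mathbb{R}$ be a nondegenerate interval, let $\omega=(\omega_1,\omega_2):I\to\mathbb{R}^2$ be a $2$-dimensional positive Chebyshev system over $I$, and let $\omega_3:I\to\mathbb{R}$ be such that $\omega^*=(\omega_1,\omega_2,\omega_3)$ is a $3$-dimensional positive Chebyshev system over $I$. Let $(t_1,t_2)\in\mathbb{R}_+^2$. Then a function $f:I\to\mathbb{R}$ is symmetrically $((t_1,t_2),\omega)$-convex on $I$ if and only if, for all $p\in I$, $$\underline{D}_{\,((t_1,t_2),\omega^* )}f(p)\ge0\qquad\text{and}\qquad\underline{D}_{\,((t_2,t_1),\omega^* )}f(p)\ge0.$$
   Context: $\mathbb{R}_+$ is the set of positive reals. $\sigma_k(I):=\{(x_1,\dots,x_k)\in I^k\mid x_1<\dots<x_k\}$. For $\omega=(\omega_1,\dots,\omega_k):I\to\mathbb{R}^k$ and $(x_1,\dots,x_k)\in\sigma_k(I)$, $\Phi_\omega(x_1,\dots,x_k):=\det\big(\omega_i(x_j)\big)_{i,j=1}^k$. $\omega$ is a $k$-dimensional positive Chebyshev system over $I$ if $\Phi_\omega>0$ on $\sigma_k(I)$. For $\omega=(\omega_1,\omega_2)$ and $f:I\to\mathbb{R}$, $(\omega,f):=(\omega_1,\omega_2,f)$. For $(s_1,s_2)\in\mathbb{R}_+^2$, $f$ is $((s_1,s_2),\omega)$-convex on $I$ if $\Phi_{(\omega,f)}(x,x+s_1h,x+(s_1+s_2)h)\ge0$ for all $h>0$ and $x\in I$ with $x+(s_1+s_2)h\in I$; $f$ is symmetrically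 $((t_1,t_2),\omega)$-convex on $I$ if it is both $((t_1,t_2),\omega)$-convex and $((t_2,t_1),\omega)$-convex on $I$. Put $$[x_0,x_1,x_2;f]_{\omega^*}:=\frac{\Phi_{(\omega,f)}(x_0,x_1,x_2)}{\Phi_{\omega^*}(x_0,x_1,x_2)}\qquad\text{for }(x_0,x_1,x_2)\in\sigma_3(I).$$ For $(s_1,s_2)\in\mathbb{R}_+^2$ and $p\in I$, the lower Dinghas type derivative (an extended real number) is $$\underline{D}_{\,((s_1,s_2),\omega^* )}f(p):=\lim_{\delta\to0^+}\inf\Big\{\big[x,\tfrac{s_2}{s_1+s_2}x+\tfrac{s_1}{s_1+s_2}y,y;f\big]_{\omega^*}: (x,y)\in\sigma_2(I),\ x\le p\le y,\ y-x<\delta\Big\}.$$ *)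

(* Defs.v *)
From mathcomp Require Import all_boot all_order all_algebra.
From mathcomp Require Import all_classical all_reals all_analysis.

Set Implicit Arguments.
Unset Strict Implicit.
Unset Printing Implicit Defensive.

Import Order.TTheory GRing.Theory Num.Theory.
Import numFieldNormedType.Exports.

Local Open Scope classical_set_scope.
Local Open Scope ring_scope.

(* Functions on an interval I are represented by total functions R -> R that
   are only ever evaluated at points of I.  A map I -> R^k is the k-tuple of
   its components; (omega, f) is [rcons_tuple omega f]. *)

Definition nondegenerate_interval (R : realType) (I : set R) : Prop :=
  is_interval I /\ exists x y, [/\ I x, I y & x < y].

Definition sigma (R : realType) (k : nat) (I : set R) : set (k.-tuple R) :=
  [set x | (forall j : 'I_k, I (tnth x j)) /\ sorted <%R x].

Definition Phi (R : realType) (k : nat) (omega : k.-tuple (R -> R))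
    (x : k.-tuple R) : R :=
  \det (\matrix_(i < k, j < k) (tnth omega i) (tnth x j)).

Definition positive_chebyshev (R : realType) (k : nat) (I : set R)
    (omega : k.-tuple (R -> R)) : Prop :=
  forall x, sigma I x -> 0 < Phi omega x.

Definition cheb_convex (R : realType) (I : set R) (s1 s2 : R)
    (omega : 2.-tuple (R -> R)) (f : R -> R) : Prop :=
  forall h x : R, 0 < h -> I x -> I (x + (s1 + s2) * h) ->
    0 <= Phi (rcons_tuple omega f)
           [tuple x; x + s1 * h; x + (s1 + s2) * h].

Definition sym_cheb_convex (R : realType) (I : set R) (t1 t2 : R)
    (omega : 2.-tuple (R -> R)) (f : R -> R) : Prop :=
  cheb_convex I t1 t2 omega f /\ cheb_convex I t2 t1 omega f.

(* The divided difference with respect to omega^* = (omega, omega3). *)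
Definition divdiff (R : realType) (omega : 2.-tuple (R -> R))
    (omega3 f : R -> R) (x : 3.-tuple R) : R :=
  Phi (rcons_tuple omega f) x / Phi (rcons_tuple omega omega3) x.

(* The infimum is nonincreasing in d, so the limit exists in \bar R. *)
Definition lower_dinghas (R : realType) (I : set R) (s1 s2 : R)
    (omega : 2.-tuple (R -> R)) (omega3 f : R -> R) (p : R) : \bar R :=
  lim (ereal_inf
         [set r | exists x y : R,
            [/\ sigma I [tuple x; y], x <= p <= y, y - x < d &
                r = (divdiff omega omega3 f
                       [tuple x; s2 / (s1 + s2) * x + s1 / (s1 + s2) * y; y])%:E]]
       @[d --> 0^'+]).

(* Main.v *)
(** If [f] violates convexity at some [x < m < y], then [f + c omega3] has a
    nonpositive determinant there for some [c > 0].  Interpolating a point on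
    each side of [m] writes this determinant as a positive combination of three
    determinants on shorter intervals, each with the original ratio or the
    swapped one, so one of the three is again nonpositive.  Iterating yields
    nested intervals shrinking to a point [p], with divided differences
    [<= - c], so that one of the two Dinghas derivatives is negative at [p]. *)

Require Import Defs.
From mathcomp Require Import all_boot all_order all_algebra.
From mathcomp Require Import all_classical all_reals all_analysis.
From mathcomp Require Import ring lra.

Set Implicit Arguments.
Unset Strict Implicit.
Unset Printing Implicit Defensive.

Import Order.TTheory GRing.Theory Num.Theory.

Local Open Scope classical_set_scope.
Local Open Scope ring_scope.

(** * Determinants of orders two and three *)

Lemma Phi2E (R : realType) (omega : 2.-tuple (R -> R)) (x y : R) :
  Phi omega [tuple x; y] =
  tnth omega ord0 x * tnth omega ord_max y
  - tnth omega ord0 y * tnth omega ord_max x.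
Proof.
rewrite /Phi (expand_det_row _ ord0) !big_ord_recl big_ord0 addr0.
rewrite /cofactor !det_mx11 !mxE /=.
case: omega => [[|w1 [|w2 []]]] //= size_omega.
rewrite !(tnth_nth 0) /= ?(tnth_nth w1) /=.
ring.
Qed.

(** Laplace expansion along the row of [f]. It displays the linearity in [f] and reduces the later
    determinant identities to polynomial ones that [ring] can settle. *)
Lemma Phi_rconsE (R : realType) (omega : 2.-tuple (R -> R)) (f : R -> R)
    (x y z : R) :
  Phi (rcons_tuple omega f) [tuple x; y; z] =
  f x * Phi omega [tuple y; z] - f y * Phi omega [tuple x; z]
  + f z * Phi omega [tuple x; y].
Proof.
rewrite !Phi2E /Phi (expand_det_row _ ord_max) !big_ord_recl big_ord0 addr0.
rewrite /cofactor !(expand_det_row _ ord0) !big_ord_recl !big_ord0 !addr0.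
rewrite /cofactor !det_mx11 !mxE /=.
case: omega => [[|w1 [|w2 []]]] //= size_omega.
rewrite !(tnth_nth 0) /= ?(tnth_nth w1) /=.
rewrite /bump /=.
ring.
Qed.

(* As functionals of [g], the two sides have equal coefficients at [x1] and
   [x3] trivially, and at [x2] by a Pluecker relation between the 2x2 minors of [omega]. *)
Lemma Phi_split (R : realType) (omega : 2.-tuple (R -> R)) (g : R -> R)
    (x0 x1 x2 x3 x4 : R) :
  Phi omega [tuple x1; x2] * Phi omega [tuple x2; x3]
    * Phi (rcons_tuple omega g) [tuple x0; x2; x4] =
  Phi omega [tuple x2; x4] * Phi omega [tuple x2; x3]
    * Phi (rcons_tuple omega g) [tuple x0; x1; x2]
  + Phi omega [tuple x2; x4] * Phi omega [tuple x0; x2]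
    * Phi (rcons_tuple omega g) [tuple x1; x2; x3]
  + Phi omega [tuple x0; x2] * Phi omega [tuple x1; x2]
    * Phi (rcons_tuple omega g) [tuple x2; x3; x4].
Proof. by rewrite !Phi_rconsE !Phi2E; ring. Qed.

Lemma positive_chebyshev2 (R : realType) (I : set R)
    (omega : 2.-tuple (R -> R)) (x y : R) :
  positive_chebyshev I omega -> I x -> I y -> x < y ->
  0 < Phi omega [tuple x; y].
Proof.
move=> omega_cheb Ix Iy xy; apply: omega_cheb; split => /=; last by rewrite xy.
by case=> [[|[|j]]] // ?; rewrite (tnth_nth 0).
Qed.

Lemma positive_chebyshev3 (R : realType) (I : set R)
    (omega : 3.-tuple (R -> R)) (x y z : R) :
  positive_chebyshev I omega -> I x -> I y -> I z -> x < y -> y < z ->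
  0 < Phi omega [tuple x; y; z].
Proof.
move=> omega_cheb Ix Iy Iz xy yz; apply: omega_cheb.
split => /=; last by rewrite xy yz.
by case=> [[|[|[|j]]]] // ?; rewrite (tnth_nth 0).
Qed.

(** In [Phi_split] every coefficient is a product of 2x2 minors at increasing nodes, hence positive.
    Three positive determinants on the right would force a positive one on the left. *)
Lemma Phi_split_le0 (R : realType) (I : set R) (omega : 2.-tuple (R -> R))
    (g : R -> R) (x0 x1 x2 x3 x4 : R) :
  positive_chebyshev I omega -> is_interval I -> I x0 -> I x4 ->
  x0 < x1 -> x1 < x2 -> x2 < x3 -> x3 < x4 ->
  Phi (rcons_tuple omega g) [tuple x0; x2; x4] <= 0 ->
  [\/ Phi (rcons_tuple omega g) [tuple x0; x1; x2] <= 0,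
      Phi (rcons_tuple omega g) [tuple x1; x2; x3] <= 0 |
      Phi (rcons_tuple omega g) [tuple x2; x3; x4] <= 0].
Proof.
move=> omega_cheb Iitv I0 I4 x01 x12 x23 x34 le0.
have Iin x : x0 <= x <= x4 -> I x by exact: Iitv.
have I1 : I x1 by apply: Iin; lra.
have I2 : I x2 by apply: Iin; lra.
have I3 : I x3 by apply: Iin; lra.
have [?|gt0l] := leP (Phi (rcons_tuple omega g) [tuple x0; x1; x2]) 0.
  exact: Or31.
have [?|gt0m] := leP (Phi (rcons_tuple omega g) [tuple x1; x2; x3]) 0.
  exact: Or32.
have [?|gt0r] := leP (Phi (rcons_tuple omega g) [tuple x2; x3; x4]) 0.
  exact: Or33.
have p12 := positive_chebyshev2 omega_cheb I1 I2 x12.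
have p23 := positive_chebyshev2 omega_cheb I2 I3 x23.
have p02 := positive_chebyshev2 omega_cheb I0 I2 (lt_trans x01 x12).
have p24 := positive_chebyshev2 omega_cheb I2 I4 (lt_trans x23 x34).
have : 0 < Phi omega [tuple x1; x2] * Phi omega [tuple x2; x3]
    * Phi (rcons_tuple omega g) [tuple x0; x2; x4].
  by rewrite Phi_split !addr_gt0 // !mulr_gt0.
by rewrite pmulr_rgt0 ?mulr_gt0 // ltNge le0.
Qed.

(** * Nested intervals *)

Lemma nested_intervals_point (R : realType) (P : R -> R -> Prop) (q : R) :
  0 <= q < 1 -> (forall x y, P x y -> x <= y) ->
  (forall x y, P x y -> exists x' y',
     [/\ P x' y', x <= x', y' <= y & y' - x' <= q * (y - x)]) ->
  forall x y, P x y -> exists p, x <= p <= y /\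
    forall d, 0 < d -> exists x' y', [/\ P x' y', x' <= p <= y' & y' - x' < d].
Proof.
move=> /andP[q0 q1] Ple step x y Pxy.
(* Iteration needs a total successor map, so [F] is constrained only on pairs satisfying [P]. *)
have /choice[F FP] (s : R * R) : exists s' : R * R, P s.1 s.2 ->
    [/\ P s'.1 s'.2, s.1 <= s'.1, s'.2 <= s.2 & s'.2 - s'.1 <= q * (s.2 - s.1)].
  have [/step[x' [y' ?]]|nP] := pselect (P s.1 s.2); first by exists (x', y').
  by exists s => /nP.
pose z n := iter n F (x, y).
have Pz n : P (z n).1 (z n).2 by elim: n => //= n /FP[].
have zl n : (z n).1 <= (z n.+1).1 by case: (FP _ (Pz n)).
have zr n : (z n.+1).2 <= (z n).2 by case: (FP _ (Pz n)).
have zlh : {homo (fun n => (z n).1) : m n / (m <= n)%N >-> m <= n}.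
  by apply: homo_leq => // ? ? ?; exact: le_trans.
have zrh : {homo (fun n => (z n).2) : m n / (m <= n)%N >-> n <= m}.
  by apply: (@homo_leq _ _ (fun u v => v <= u)) => // ? ? ? ? /le_trans; apply.
(* Endpoints with different indices are compared through the interval of index [maxn m n]. *)
have zlr m n : (z m).1 <= (z n).2.
  apply: (le_trans (zlh _ _ (leq_maxl m n))).
  exact: le_trans (Ple _ _ (Pz _)) (zrh _ _ (leq_maxr m n)).
have zlen n : (z n).2 - (z n).1 <= q ^+ n * (y - x).
  elim: n => [|n IH]; first by rewrite expr0 mul1r.
  have [_ _ _ /le_trans->//] := FP _ (Pz n).
  by rewrite exprS -mulrA ler_wpM2l.
pose p := sup (range (fun n => (z n).1)).
have pP n : (z n).1 <= p <= (z n).2.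
  apply/andP; split.
    by apply: ub_le_sup; [exists y => _ [m _ <-]; exact: (zlr m 0)|exists n].
  by apply: ge_sup; [exists x, 0%N|move=> _ [m _ <-]; exact: zlr].
exists p; split; first exact: (pP 0%N).
move=> d d0.
have : geometric (y - x) q n @[n --> \oo] --> 0.
  by apply: cvg_geometric; rewrite ger0_norm.
move=> /cvgr_lt/(_ d d0)[N _ /(_ N (leqnn N))] /= ltd.
exists (z N).1, (z N).2; split=> //.
by apply: le_lt_trans ltd; rewrite /geometric/= mulrC.
Qed.

(** * The lower Dinghas derivative as a limit of infima *)

(** A name for the set inside [lower_dinghas], to which it unfolds. *)
Definition dinghas_quotients (R : realType) (I : set R) (s1 s2 : R)
    (omega : 2.-tuple (R -> R)) (omega3 f : R -> R) (p d : R) : set (\bar R) :=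
  [set r | exists x y : R,
     [/\ sigma I [tuple x; y], x <= p <= y, y - x < d &
         r = (divdiff omega omega3 f
                [tuple x; s2 / (s1 + s2) * x + s1 / (s1 + s2) * y; y])%:E]].

(** Enlarging [d] enlarges the set of quotients, so the infimum is monotone. Convergence is what
    gives [lim] its intended value and lets bounds pass to it. *)
Lemma is_cvg_lower_dinghas (R : realType) (I : set R) (s1 s2 : R)
    (omega : 2.-tuple (R -> R)) (omega3 f : R -> R) (p : R) :
  cvg (ereal_inf (dinghas_quotients I s1 s2 omega omega3 f p d) @[d --> 0^'+]).
Proof.
apply: nonincreasing_at_right_is_cvge; near=> e => d d' _ _ dd'.
apply: ereal_inf_le_tmp => _ [x [y [sxy pxy lt_d ->]]].
by exists x, y; split => //; exact: lt_le_trans lt_d dd'.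
Unshelve. all: by end_near. Qed.

Lemma lower_dinghas_ge (R : realType) (I : set R) (s1 s2 : R)
    (omega : 2.-tuple (R -> R)) (omega3 f : R -> R) (p : R) (b : \bar R) :
  (forall d, lbound (dinghas_quotients I s1 s2 omega omega3 f p d) b) ->
  (b <= lower_dinghas I s1 s2 omega omega3 f p)%E.
Proof.
move=> lb; apply: lime_ge; first exact: is_cvg_lower_dinghas.
by apply: nearW => d; apply: le_ereal_inf_tmp; exact: lb.
Qed.

(** If no such [d] existed, the infimum would be at most [b] for every positive [d], and so would
    the limit. *)
Lemma lt_lower_dinghas (R : realType) (I : set R) (s1 s2 : R)
    (omega : 2.-tuple (R -> R)) (omega3 f : R -> R) (p : R) (b : \bar R) :
  (b < lower_dinghas I s1 s2 omega omega3 f p)%E ->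
  exists2 d, 0 < d & forall r,
    dinghas_quotients I s1 s2 omega omega3 f p d r -> (b < r)%E.
Proof.
move=> ltb; apply: contrapT => nd; move: ltb; apply/negP; rewrite -leNgt.
apply: lime_le; first exact: is_cvg_lower_dinghas.
near=> d; rewrite leNgt; apply/negP => ltb.
apply: nd; exists d; first by near: d; exact: nbhs_right_gt.
by move=> r /ereal_inf_lbound; exact: lt_le_trans.
Unshelve. all: by end_near. Qed.

(** * Localizing a nonpositive determinant at a point *)

Lemma Phi_le0_shrink (R : realType) (I : set R) (omega : 2.-tuple (R -> R))
    (g : R -> R) (a x y : R) :
  positive_chebyshev I omega -> is_interval I -> 0 < a < 1 ->
  I x -> I y -> x < y ->
  Phi (rcons_tuple omega g) [tuple x; (1 - a) * x + a * y; y] <= 0 ->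
  exists p, x <= p <= y /\ forall d, 0 < d -> exists x' y',
    [/\ [/\ I x', I y' & x' < y'],
        exists2 b, b \in [:: a; 1 - a] &
          Phi (rcons_tuple omega g) [tuple x'; (1 - b) * x' + b * y'; y'] <= 0,
        x' <= p <= y' & y' - x' < d].
Proof.
move=> omega_cheb Iitv a01 Ix Iy xy le0.
(* The invariant of the shrinking. A subdivision may swap the ratio, so it is only recorded to be
   one of [a] and [1 - a]. *)
pose P x y := [/\ I x, I y & x < y] /\ exists2 b, b \in [:: a; 1 - a] &
  Phi (rcons_tuple omega g) [tuple x; (1 - b) * x + b * y; y] <= 0.
have Pxy : P x y by split; [|exists a; rewrite ?inE ?eqxx].
have q01 : 0 <= Num.max a (1 - a) < 1.
  rewrite le_max gt_max; apply/andP.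
  by split; [apply/orP; left|apply/andP; split]; lra.
have Ple u v : P u v -> u <= v by case=> -[_ _ /ltW].
suff step u v : P u v -> exists u' v',
    [/\ P u' v', u <= u', v' <= v & v' - u' <= Num.max a (1 - a) * (v - u)].
  have [p [pxy pP]] := nested_intervals_point q01 Ple step Pxy.
  exists p; split=> // d /pP[x' [y' [[? ?] ? ?]]].
  by exists x', y'.
move=> {x y Ix Iy xy le0 Pxy} [[Iu Iv uv] [b ba le0]].
have b01 : 0 < b < 1 by move: ba; rewrite !inE => /orP[]/eqP->; lra.
have cba : 1 - b \in [:: a; 1 - a].
  move: ba; rewrite !inE => /orP[]/eqP->; rewrite ?eqxx ?orbT //.
  by rewrite opprB addrC subrK eqxx.
have bq : b <= Num.max a (1 - a).
  by move: ba; rewrite !inE => /orP[]/eqP->; rewrite le_max lexx ?orbT.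
have cbq : 1 - b <= Num.max a (1 - a).
  by move: cba; rewrite !inE => /orP[]/eqP->; rewrite le_max lexx ?orbT.
have {q01} q0 : 0 <= Num.max a (1 - a) by case/andP: q01.
set q := Num.max a (1 - a) in q0 bq cbq *.
(* The new points cut [u, m] and [m', v'] in the ratio b : 1 - b and [m, v] in
   the ratio 1 - b : b; hence the symmetric hypothesis in the theorem. *)
pose m := (1 - b) * u + b * v.
pose u' := (1 - b) * u + b * m.
pose v' := (1 - (1 - b)) * m + (1 - b) * v.
have mE : m = (1 - b) * u' + b * v' by rewrite /u' /v' /m; ring.
have um : m - u = b * (v - u) by rewrite /m; ring.
have mv : v - m = (1 - b) * (v - u) by rewrite /m; ring.
have uu' : u' - u = b * (b * (v - u)) by rewrite /u' /m; ring.
have u'm : m - u' = (1 - b) * (b * (v - u)) by rewrite /u' /m; ring.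
have mv' : v' - m = (1 - b) * ((1 - b) * (v - u)) by rewrite /v' /m; ring.
have v'v : v - v' = b * ((1 - b) * (v - u)) by rewrite /v' /m; ring.
have u'v' : v' - u' = (1 - b) * (v - u) by rewrite /u' /v' /m; ring.
have vu0 : 0 < v - u by rewrite subr_gt0.
have b0 : 0 < b by lra.
have cb0 : 0 < 1 - b by lra.
(* The three candidate intervals have lengths [b], [1 - b] and [1 - b] times [v - u]; both factors
   are at most [q]. *)
have bv := ler_wpM2r (ltW vu0) bq.
have cbv := ler_wpM2r (ltW vu0) cbq.
have lt_uu' : u < u' by rewrite -subr_gt0 uu' !mulr_gt0.
have lt_u'm : u' < m by rewrite -subr_gt0 u'm !mulr_gt0.
have lt_mv' : m < v' by rewrite -subr_gt0 mv' !mulr_gt0.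
have lt_v'v : v' < v by rewrite -subr_gt0 v'v !mulr_gt0.
have Iin z : u <= z <= v -> I z by exact: Iitv.
have Im : I m by apply: Iin; lra.
have Iu' : I u' by apply: Iin; lra.
have Iv' : I v' by apply: Iin; lra.
have [le|le|le] :=
  Phi_split_le0 omega_cheb Iitv Iu Iv lt_uu' lt_u'm lt_mv' lt_v'v le0.
- exists u, m; split; try lra.
  by split; [split=> //; lra|exists b].
- exists u', v'; split; try lra.
  by split; [split=> //; lra|exists b; rewrite -?mE].
- exists m, v; split; try lra.
  by split; [split=> //; lra|exists (1 - b)].
Qed.

(** * The two implications *)

Lemma Phi_rconsD (R : realType) (omega : 2.-tuple (R -> R)) (f g : R -> R)
    (c x y z : R) :
  Phi (rcons_tuple omega (fun t => f t + c * g t)) [tuple x; y; z] =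
  Phi (rcons_tuple omega f) [tuple x; y; z]
  + c * Phi (rcons_tuple omega g) [tuple x; y; z].
Proof. by rewrite !Phi_rconsE; ring. Qed.

(** Already each quotient is nonnegative: its numerator is a convexity determinant and its
    denominator is positive. *)
Lemma cheb_convex_dinghas_ge0 (R : realType) (I : set R)
    (omega : 2.-tuple (R -> R)) (omega3 f : R -> R) (s1 s2 p : R) :
  is_interval I -> positive_chebyshev I (rcons_tuple omega omega3) ->
  0 < s1 -> 0 < s2 -> cheb_convex I s1 s2 omega f ->
  (0 <= lower_dinghas I s1 s2 omega omega3 f p)%E.
Proof.
move=> Iitv omegastar_cheb s1_gt0 s2_gt0 fconv.
apply: lower_dinghas_ge => d _ [x [y [[Ixy xy] _ _ ->]]].
have Ix : I x by have := Ixy ord0; rewrite (tnth_nth 0).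
have Iy : I y by have := Ixy ord_max; rewrite (tnth_nth 0).
have {}xy : x < y by move: xy; rewrite /= andbT.
have s_gt0 : 0 < s1 + s2 by rewrite addr_gt0.
have s_neq0 : s1 + s2 != 0 by rewrite gt_eqF.
(* The step for which [y] and the intermediate node take the form used in [cheb_convex]. *)
pose h := (y - x) / (s1 + s2).
have h_gt0 : 0 < h by rewrite divr_gt0 ?subr_gt0.
have mE : s2 / (s1 + s2) * x + s1 / (s1 + s2) * y = x + s1 * h.
  by rewrite /h; field.
have yE : y = x + (s1 + s2) * h by rewrite /h; field.
have xm : x < x + s1 * h by rewrite ltrDl mulr_gt0.
have my : x + s1 * h < y by rewrite yE ltrD2l ltr_pM2r // ltrDl.
have Im : I (x + s1 * h) by apply: (Iitv x y) => //; lra.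
rewrite lee_fin mE divr_ge0 //.
  by rewrite [in X in [tuple _; _; X]]yE fconv // -yE.
exact/ltW/(positive_chebyshev3 omegastar_cheb).
Qed.

(** Convexity for a single ratio uses both derivatives, because the shrinking does not control which
    of the two ratios it ends with. *)
Lemma dinghas_ge0_cheb_convex (R : realType) (I : set R)
    (omega : 2.-tuple (R -> R)) (omega3 f : R -> R) (s1 s2 : R) :
  is_interval I -> positive_chebyshev I omega ->
  positive_chebyshev I (rcons_tuple omega omega3) -> 0 < s1 -> 0 < s2 ->
  (forall p, I p -> (0 <= lower_dinghas I s1 s2 omega omega3 f p)%E) ->
  (forall p, I p -> (0 <= lower_dinghas I s2 s1 omega omega3 f p)%E) ->
  cheb_convex I s1 s2 omega f.
Proof.
move=> Iitv omega_cheb omegastar_cheb s1_gt0 s2_gt0 D12 D21 h x h_gt0 Ix Iy.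
have s_gt0 : 0 < s1 + s2 by rewrite addr_gt0.
have s_neq0 : s1 + s2 != 0 by rewrite gt_eqF.
pose a := s1 / (s1 + s2).
have caE : 1 - a = s2 / (s1 + s2) by rewrite /a; field.
have a_gt0 : 0 < a by rewrite divr_gt0.
have ca_gt0 : 0 < 1 - a by rewrite caE divr_gt0.
have a01 : 0 < a < 1 by lra.
set y := x + (s1 + s2) * h in Iy *.
have xy : x < y by rewrite ltrDl mulr_gt0.
have -> : x + s1 * h = (1 - a) * x + a * y by rewrite /y /a; field.
have mxy (b u v : R) : 0 < b < 1 -> u < v -> u < (1 - b) * u + b * v < v.
  by move=> b01 uv; apply/andP; split; nra.
rewrite leNgt; apply/negP => lt0.
have /andP[xm my] := mxy _ _ _ a01 xy.
have Im : I ((1 - a) * x + a * y) by apply: (Iitv x y) => //; lra.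
have := positive_chebyshev3 omegastar_cheb Ix Im Iy xm my.
set N := Phi _ _ in lt0; set D := Phi _ _ => D_gt0.
(* With this [c] the determinant of [g] at the initial triple is exactly zero. On the smaller
   triples, nonpositivity for [g] means a divided difference of [f] at most [- c]. *)
pose c := - N / D.
have c_gt0 : 0 < c by rewrite divr_gt0 // oppr_gt0.
pose g t := f t + c * omega3 t.
have g0 : Phi (rcons_tuple omega g) [tuple x; (1 - a) * x + a * y; y] <= 0.
  by rewrite Phi_rconsD -/N -/D /c divfK ?gt_eqF // subrr.
have [p [pxy pP]] := Phi_le0_shrink omega_cheb Iitv a01 Ix Iy xy g0.
have Ip : I p by exact: Iitv pxy.
have ltD b : (0 <= b -> - c%:E < b)%E.
  by move=> b0; rewrite (lt_le_trans _ b0) // -EFinN lte_fin oppr_lt0.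
have [d1 d1_gt0 d1P] := lt_lower_dinghas (ltD _ (D12 _ Ip)).
have [d2 d2_gt0 d2P] := lt_lower_dinghas (ltD _ (D21 _ Ip)).
(* One radius serves both derivatives, as the ratio [b] on the short interval is not known
   beforehand. *)
have d_gt0 : 0 < Num.min d1 d2 by rewrite lt_min d1_gt0.
have [u [v [[Iu Iv uv] [b ba gle0] puv]]] := pP _ d_gt0.
rewrite lt_min => /andP[uvd1 uvd2].
have b01 : 0 < b < 1 by move: ba; rewrite !inE => /orP[]/eqP->; lra.
have suv : sigma I [tuple u; v].
  by split; [case=> [[|[|j]]] // ?; rewrite (tnth_nth 0)|rewrite /= uv].
have : - c < divdiff omega omega3 f [tuple u; (1 - b) * u + b * v; v].
  rewrite -lte_fin EFinN.
  (* The ratio [a] falls under the derivative for [(s1, s2)], and [1 - a] under the one for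
     [(s2, s1)]. *)
  move: ba; rewrite !inE => /orP[]/eqP->.
    by apply: d1P; exists u, v; rewrite -caE.
  apply: d2P; exists u, v; split=> //.
  rewrite [s2 + s1]addrC -/a -caE.
  by congr (divdiff _ _ _ [tuple _; _ * _ + _; _])%:E; ring.
have /andP[um mv] := mxy _ _ _ b01 uv.
have Iw : I ((1 - b) * u + b * v) by apply: (Iitv u v) => //; lra.
have Phi3_gt0 := positive_chebyshev3 omegastar_cheb Iu Iw Iv um mv.
rewrite /divdiff ltr_pdivlMr // ltNge; apply/negP; rewrite negbK.
by move: gle0; rewrite Phi_rconsD; lra.
Qed.

Theorem corollary17 (R : realType) (I : set R) (omega : 2.-tuple (R -> R))
    (omega3 : R -> R) (t1 t2 : R) (f : R -> R)
    (I_interval : nondegenerate_interval I)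
    (omega_cheb : positive_chebyshev I omega)
    (omegastar_cheb : positive_chebyshev I (rcons_tuple omega omega3))
    (t1_gt0 : 0 < t1) (t2_gt0 : 0 < t2) :
  sym_cheb_convex I t1 t2 omega f <->
  (forall p : R, I p ->
     (0 <= lower_dinghas I t1 t2 omega omega3 f p)%E /\
     (0 <= lower_dinghas I t2 t1 omega omega3 f p)%E).
Proof.
have [Iitv _] := I_interval.
split=> [[f12 f21] p Ip|D].
  by split; exact: cheb_convex_dinghas_ge0.
by split; apply: (dinghas_ge0_cheb_convex (omega3 := omega3)) => // p /D[].
Qed.
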